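(* Let $G$ be a finite graph with arbitrary probabilities on its edges, let $0,b\in G$ be two vertices and let $A\subset G$ be a set of vertices with $|A|=3$. Assume that $A$ separates $0$ from $b$, namely, that any path in $G$ from $0$ to $b$ must pass through a vertex of $A$. Then $$\mathbb{P}(0\leftrightarrow b,\ 0\leftrightarrow A)\ \ge\ \min\{\mathbb{P}(0\leftrightarrow A,\ a\leftrightarrow b): a\in A\}.$$
   Context: A graph is identified with its vertex set. Each edge $e\in E(G)$ carries a number $p(e)\in[0,1]$, and $\omega\subseteq E(G)$ is a random set of edges in which every edge $e$ is included (is ''open'') with probability $p(e)$, independently; $\mathbb{P}$ is the resulting probability measure. $v\leftrightarrow w$ denotes the event that $v$ and $w$ are connected by a path of open edges (or $v=w$). For a set of vertices $A$, $v\leftrightarrow A$ means $v\leftrightarrow a$ for some $a\in A$. *)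

(* Defs.v *)
From mathcomp Require Import all_boot all_order all_algebra.
From mathcomp Require Import reals.

Set Implicit Arguments.
Unset Strict Implicit.
Unset Printing Implicit Defensive.

Import Order.TTheory GRing.Theory Num.Theory.
Local Open Scope ring_scope.

(* A finite simple graph is a symmetric irreflexive relation on V : finType;
   an edge is the unordered pair of its endpoints. *)
Definition edges (V : finType) (adj : rel V) : {set {set V}} :=
  [set [set u.1; u.2] | u : V * V & adj u.1 u.2].

(* Only the values of p on E matter; the other junk sets carry no weight since
   omega ranges over subsets of E. *)
Definition percolation_prob (R : realType) (V : finType) (E : {set {set V}})
    (p : {set V} -> R) (event : pred {set {set V}}) : R :=
  \sum_(omega : {set {set V}} | (omega \subset E) && event omega)
    ((\prod_(e in omega) p e) * \prod_(e in E :\: omega) (1 - p e)).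

Definition open_adj (V : finType) (omega : {set {set V}}) : rel V :=
  fun x y => [set x; y] \in omega.

Definition connected (V : finType) (v w : V) : pred {set {set V}} :=
  fun omega => connect (open_adj omega) v w.

Definition connected_to (V : finType) (v : V) (A : {set V}) :
    pred {set {set V}} :=
  fun omega => [exists a in A, connected v a omega].

Definition separates (V : finType) (adj : rel V) (A : {set V}) (x y : V) :
    Prop :=
  forall q : seq V, path adj x q -> uniq (x :: q) -> last x q = y ->
    exists2 a, a \in A & a \in x :: q.

(* Main.v *)
Require Import Defs.
From mathcomp Require Import all_boot all_order all_algebra.
From mathcomp Require Import reals ring lra.

Import Order.TTheory GRing.Theory Num.Theory.
Local Open Scope ring_scope.

(* Let S be the component of o outside A. The edges meeting S (the side of o)
   and the other ones (the side of b) are independent, and each side acts only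
   through the partition it induces on A and o, resp. on A and b. This makes the
   three differences P(o <-> b, o <-> A) - P(o <-> A, a <-> b), a in A, explicit
   bilinear forms in the pattern probabilities q_i = P(o i | j | k),
   r_i = P(o i | j k), s_i = P(o j k | i) and their analogues for b.

   The correlation inequalities of van den Berg, Haggstrom and Kahn for the
   clusters of i and of {j, k}, given that they are distinct, yield
   r_i (q_j + q_k) <= q_i s_i on both sides. With the terminals ordered by the
   b-side quantity u_i + v_i - w_i, these force one of the three weighted sums
   of the differences with weights (1, 0, 0), (q_1, q_2, 0) or (q_1, q_2, q_3)
   to be nonnegative, except for degenerate cases where all q_i vanish, so the
   differences are not all negative.

   The correlation inequalities follow by revealing the edges touching common
   sources one at a time with the four-functions inequality for one bit; once
   no such edge is left, they reduce to Harris' inequality. *)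

Set Implicit Arguments.
Unset Strict Implicit.
Unset Printing Implicit Defensive.

(** * Elementary inequalities *)

Section Algebra.
Variable R : realFieldType.

(** One-bit case of the Ahlswede-Daykin four-functions theorem. The terms in p^2 and (1-p)^2 compare
    one by one, the mixed terms only as a sum. *)
Lemma four_functions_bit (p a0 a1 b0 b1 c0 c1 d0 d1 : R) :
  0 <= p <= 1 ->
  0 <= a0 -> 0 <= a1 -> 0 <= b0 -> 0 <= b1 ->
  0 <= c0 -> 0 <= c1 -> 0 <= d0 -> 0 <= d1 ->
  a0 * b0 <= c0 * d0 -> a1 * b1 <= c1 * d1 ->
  a1 * b0 <= c1 * d0 -> a0 * b1 <= c1 * d0 ->
  (p * a1 + (1 - p) * a0) * (p * b1 + (1 - p) * b0) <=
  (p * c1 + (1 - p) * c0) * (p * d1 + (1 - p) * d0).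
Proof.
move=> /andP[p0 p1] a0p a1p b0p b1p c0p c1p d0p d1p h00 h11 h10 h01.
(* Both products x and y on the left are at most M = c1 d0, so (M - x)(M - y) >= 0 gives M (x + y)
   <= M^2 + x y, while x y <= M c0 d1. *)
have mid : a1 * b0 + a0 * b1 <= c1 * d0 + c0 * d1.
  have [M0|M0] := eqVneq (c1 * d0) 0.
    have := mulr_ge0 c0p d1p; rewrite M0 in h10 h01 *; lra.
  have Mp : 0 < c1 * d0 by rewrite lt_neqAle eq_sym M0 mulr_ge0.
  rewrite -(ler_pM2l Mp).
  have h : (a1 * b1) * (a0 * b0) <= (c1 * d1) * (c0 * d0).
    by apply: ler_pM => //; apply: mulr_ge0.
  have h' : 0 <= (c1 * d0 - a1 * b0) * (c1 * d0 - a0 * b1).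
    by apply: mulr_ge0; rewrite subr_ge0.
  by nra.
have := ler_wpM2l (mulr_ge0 p0 p0) h11.
have q0 : 0 <= 1 - p by lra.
have := ler_wpM2l (mulr_ge0 q0 q0) h00.
have := ler_wpM2l (mulr_ge0 p0 q0) mid.
by lra.
Qed.

Lemma weighted_neg (x y z d e f : R) :
  0 <= x -> 0 <= y -> 0 <= z -> x + y + z != 0 ->
  d < 0 -> e < 0 -> f < 0 -> x * d + y * e + z * f < 0.
Proof.
move=> xp yp zp n0 d0 e0 f0.
have m1 := mulr_ge0_le0 xp (ltW d0); have m2 := mulr_ge0_le0 yp (ltW e0).
have m3 := mulr_ge0_le0 zp (ltW f0).
have pos (t : R) : 0 <= t -> t != 0 -> 0 < t by move=> tp tn; rewrite lt_def tn.
have [x0|/(pos _ xp) x0] := eqVneq x 0; last first.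
  by have : x * d < 0 by [rewrite pmulr_rlt0]; lra.
have [y0|/(pos _ yp) y0] := eqVneq y 0; last first.
  by have : y * e < 0 by [rewrite pmulr_rlt0]; lra.
have z0 : 0 < z by apply: pos => //; apply: contra n0 => /eqP z0; apply/eqP; lra.
by have : z * f < 0 by [rewrite pmulr_rlt0]; lra.
Qed.

(* For a root z joined by random edges to three terminals, q_i, r_i and s_i are
   the probabilities of the patterns zi|j|k, zi|jk and zjk|i. *)
Record profile (q1 q2 q3 r1 r2 r3 s1 s2 s3 : R) : Prop := Profile {
  profile_q : [/\ 0 <= q1, 0 <= q2 & 0 <= q3];
  profile_r : [/\ 0 <= r1, 0 <= r2 & 0 <= r3];
  profile_s : [/\ 0 <= s1, 0 <= s2 & 0 <= s3];
  profile_le : [/\ r1 * (q2 + q3) <= q1 * s1, r2 * (q1 + q3) <= q2 * s2 &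
                   r3 * (q1 + q2) <= q3 * s3];
  profile_degenerate : q1 + q2 + q3 = 0 ->
    [/\ r1 * (r2 + s2) = 0 /\ r1 * (r3 + s3) = 0,
        r2 * (r1 + s1) = 0 /\ r2 * (r3 + s3) = 0 &
        r3 * (r1 + s1) = 0 /\ r3 * (r2 + s2) = 0] }.

Lemma profile_swap12 q1 q2 q3 r1 r2 r3 s1 s2 s3 :
  profile q1 q2 q3 r1 r2 r3 s1 s2 s3 -> profile q2 q1 q3 r2 r1 r3 s2 s1 s3.
Proof.
case=> [[? ? ?]] [? ? ?] [? ? ?] [? ? ?] h; split=> //; split=> //.
- by rewrite [q2 + q1]addrC.
- by have [_ []] := h ltac:(by rewrite [q1 + q2]addrC).
- by have [[]] := h ltac:(by rewrite [q1 + q2]addrC).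
- by have [_ _ []] := h ltac:(by rewrite [q1 + q2]addrC).
Qed.

Lemma profile_swap23 q1 q2 q3 r1 r2 r3 s1 s2 s3 :
  profile q1 q2 q3 r1 r2 r3 s1 s2 s3 -> profile q1 q3 q2 r1 r3 r2 s1 s3 s2.
Proof.
case=> [[? ? ?]] [? ? ?] [? ? ?] [? ? ?] h; split=> //; split=> //.
- by rewrite [q3 + q2]addrC.
- by have [[]] := h ltac:(by rewrite addrAC).
- by have [_ _ []] := h ltac:(by rewrite addrAC).
- by have [_ []] := h ltac:(by rewrite addrAC).
Qed.

Lemma le_of_mul_le (v t u w : R) :
  v * t <= u * w -> 0 <= u -> 0 <= w -> w < v -> t <= u.
Proof.
move=> h u0 w0 wv; have v0 := le_lt_trans w0 wv.
by rewrite -(ler_pM2l v0) (le_trans h) // mulrC ler_wpM2r // ltW.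
Qed.

(** [B1 - u2 - u3] and its analogues are the factors of the [r] and [s] in [deficit]. If the first
    were positive, [profile_le] would give u2 >= u1 + u3 and u3 >= u1 + u2, hence u1 = 0 and u2 =
    u3, which is contradictory. For the second claim, B3 >= B2 > u1 + u3 makes v3 > w3, hence u3 >=
    u1 + u2. *)
Lemma profile_sorted_signs (u1 u2 u3 v1 v2 v3 w1 w2 w3 : R)
    (B1 := u1 + v1 - w1) (B2 := u2 + v2 - w2) (B3 := u3 + v3 - w3) :
  profile u1 u2 u3 v1 v2 v3 w1 w2 w3 -> B1 <= B2 -> B2 <= B3 ->
  B1 - u2 - u3 <= 0 /\ (0 < B2 - u1 - u3 -> 0 <= B3 - u1 - u2).
Proof.
rewrite /B1 /B2 /B3 => {B1 B2 B3} -[[u1p u2p u3p] [v1p v2p v3p] [w1p w2p w3p]].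
move=> [_ h2 h3] deg B12 B23; split.
  rewrite leNgt; apply/negP => g1p.
  have x2 : u3 < v2 - w2 by clear -g1p B12; lra.
  have x3 : u2 < v3 - w3 by clear -g1p B12 B23; lra.
  have k2 : u1 + u3 <= u2 by apply: le_of_mul_le h2 _ _ _ => //; clear -x2 u3p; lra.
  have k3 : u1 + u2 <= u3 by apply: le_of_mul_le h3 _ _ _ => //; clear -x3 u2p; lra.
  have u10 : u1 = 0 by clear -k2 k3 u1p; lra.
  have u23 : u3 = u2 by clear -k2 k3 u1p; lra.
  have [u20|u2n] := eqVneq u2 0.
    have [_ [_ /eqP]] := deg ltac:(by rewrite u10 u23 u20 !addr0).
    rewrite mulf_eq0 => /orP[]/eqP; [clear -x2 u3p w2p | clear -x3 u2p v3p w3p]; lra.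
  move: h2; rewrite u10 u23 add0r [v2 * _]mulrC ler_pM2l ?lt_def ?u2n //.
  by clear -x2 u3p; lra.
move=> g2p; rewrite leNgt; apply/negP => g3n.
have x3 : w3 < v3 by clear -g2p g3n B23 u1p; lra.
have := le_of_mul_le h3 u3p w3p x3.
by clear -g2p g3n B23 u1p; lra.
Qed.

(** If g2 > 0, the first deficit is a sum of nonnegative terms. If no [g] is positive, the weights
    q_i cancel the [B] terms and [profile_le] makes each coefficient of g_i nonpositive. If only g3
    > 0, the weights (q1, q2, 0) work. *)
Lemma some_deficit_ge0_signs (q1 q2 q3 r1 r2 r3 s1 s2 s3 : R)
    (B1 B2 B3 g1 g2 g3 : R) :
  profile q1 q2 q3 r1 r2 r3 s1 s2 s3 -> B1 <= B2 -> B2 <= B3 ->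
  g1 <= 0 -> (0 < g2 -> 0 <= g3) ->
  q2 * (B2 - B1) + q3 * (B3 - B1) + r2 * g2 + r3 * g3 - s1 * g1 < 0 ->
  q1 * (B1 - B2) + q3 * (B3 - B2) + r1 * g1 + r3 * g3 - s2 * g2 < 0 ->
  q1 * (B1 - B3) + q2 * (B2 - B3) + r1 * g1 + r2 * g2 - s3 * g3 < 0 -> False.
Proof.
case=> [[q1p q2p q3p]] [r1p r2p r3p] [s1p s2p s3p] [hr1 hr2 hr3] deg B12 B23 g1n g23.
have sm x y : 0 <= x -> 0 <= y -> 0 <= x * y := @mulr_ge0 R x y.
have B21 : 0 <= B2 - B1 by rewrite subr_ge0.
have B32 : 0 <= B3 - B2 by rewrite subr_ge0.
have B31 : 0 <= B3 - B1 by rewrite subr_ge0 (le_trans B12).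
have n1 := mulr_ge0_le0 s1p g1n.
have [g2p|g2n] := ltP 0 g2.
  have h1 := sm _ _ q2p B21; have h2 := sm _ _ q3p B31.
  have h3 := sm _ _ r2p (ltW g2p); have h4 := sm _ _ r3p (g23 g2p).
  by clear -h1 h2 h3 h4 n1; lra.
have n2 := mulr_ge0_le0 s2p g2n.
have e1 : 0 <= q1 * s1 - r1 * (q2 + q3) by rewrite subr_ge0.
have e2 : 0 <= q2 * s2 - r2 * (q1 + q3) by rewrite subr_ge0.
have f1 := mulr_ge0_le0 e1 g1n; have f2 := mulr_ge0_le0 e2 g2n.
have [q0|qn] := eqVneq (q1 + q2 + q3) 0.
  have q10 : q1 = 0 by clear -q0 q1p q2p q3p; lra.
  have q20 : q2 = 0 by clear -q0 q1p q2p q3p; lra.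
  have q30 : q3 = 0 by clear -q0 q1p q2p q3p; lra.
  have [[h12 h13] [h21 h23] [h31 h32]] := deg q0.
  (* When all q_i vanish, a nonzero r_i kills the other r_j, so some deficit is visibly
     nonnegative. *)
  have kill (x y z : R) : 0 <= y -> 0 <= z -> x * (y + z) = 0 -> x != 0 -> y = 0.
    move=> yp zp /eqP; rewrite mulf_eq0 => /orP[/eqP->|]; first by rewrite eqxx.
    by rewrite paddr_eq0 // => /andP[/eqP].
  rewrite q10 q20 q30 !mul0r !add0r => {e1 e2 f1 f2}.
  have [r1z|r1n] := eqVneq r1 0; last first.
    rewrite (kill _ _ _ r2p s2p h12 r1n) (kill _ _ _ r3p s3p h13 r1n).
    by move=> D1 _ _; clear -D1 n1; lra.
  have [r2z|r2n] := eqVneq r2 0; last first.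
    rewrite r1z (kill _ _ _ r3p s3p h23 r2n) => _ D2 _.
    by clear -D2 n2; lra.
  have [g3p|g3n] := ltP 0 g3.
    by have h := sm _ _ r3p (ltW g3p); rewrite r2z => D1 _ _; clear -D1 n1 h; lra.
  have n3 := mulr_ge0_le0 s3p g3n.
  by rewrite r1z r2z => _ _ D3; clear -D3 n3; lra.
have [g3p|g3n] := ltP 0 g3; last first.
  have e3 : 0 <= q3 * s3 - r3 * (q1 + q2) by rewrite subr_ge0.
  have f3 := mulr_ge0_le0 e3 g3n.
  move=> D1 D2 D3; have := weighted_neg q1p q2p q3p qn D1 D2 D3.
  by clear -f1 f2 f3; lra.
have h3 := sm _ _ r3p (ltW g3p).
(* If q1 = q2 = 0, the weights (q1, q2, 0) say nothing; but then q3 > 0 forces r2 = 0 and the first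
   deficit is nonnegative. *)
have [q120|q120] := eqVneq (q1 + q2 + 0) 0.
  have q20 : q2 = 0 by clear -q120 q1p q2p; lra.
  have q3n : q3 != 0 by move: qn; rewrite -[q1 + q2]addr0 q120 add0r.
  have r20 : r2 = 0.
    have : r2 * q3 <= 0.
      by move: hr2; rewrite q20 mul0r mulrDr; have := sm _ _ r2p q1p; clear; lra.
    by move=> h; apply/eqP; have := sm _ _ r2p q3p; rewrite le_eqVlt
      ltNge h orbF eq_sym mulf_eq0 (negbTE q3n) orbF.
  have h := sm _ _ q3p B31.
  by rewrite r20 q20 => D1 _ _; clear -D1 h h3 n1; lra.
have h1 := sm _ _ (addr_ge0 q1p q2p) h3.
(* The [B] terms leave q1 q3 (B3 - B1) + q2 q3 (B3 - B2), nonnegative by sorting. *)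
have h2 := sm _ _ q3p (sm _ _ q1p B31).
have h4 := sm _ _ q3p (sm _ _ q2p B32).
have h5 := mulr_ge0_le0 (sm _ _ r1p q3p) g1n.
have h6 := mulr_ge0_le0 (sm _ _ r2p q3p) g2n.
move=> D1 D2 D3; have := weighted_neg q1p q2p (lexx 0) q120 D1 D2 D3.
by clear -h1 h2 h4 h5 h6 f1 f2; lra.
Qed.

(* P(o <-> b, o <-> A) - P(o <-> A, a1 <-> b) for A = {a1, a2, a3}, where q, r, s
   is the profile of o and u, v, w that of b. *)
Definition deficit (q2 q3 r2 r3 s1 u1 u2 u3 v1 v2 v3 w1 w2 w3 : R) :=
  q2 * ((u2 + v2 - w2) - (u1 + v1 - w1)) + q3 * ((u3 + v3 - w3) - (u1 + v1 - w1))
  + r2 * (u2 + v2 - w2 - u1 - u3) + r3 * (u3 + v3 - w3 - u1 - u2)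
  - s1 * (u1 + v1 - w1 - u2 - u3).

Lemma some_deficit_ge0 (q1 q2 q3 r1 r2 r3 s1 s2 s3 : R)
    (u1 u2 u3 v1 v2 v3 w1 w2 w3 : R) :
  profile q1 q2 q3 r1 r2 r3 s1 s2 s3 -> profile u1 u2 u3 v1 v2 v3 w1 w2 w3 ->
  [\/ 0 <= deficit q2 q3 r2 r3 s1 u1 u2 u3 v1 v2 v3 w1 w2 w3,
      0 <= deficit q1 q3 r1 r3 s2 u2 u1 u3 v2 v1 v3 w2 w1 w3 |
      0 <= deficit q1 q2 r1 r2 s3 u3 u1 u2 v3 v1 v2 w3 w1 w2].
Proof.
have sw x1 x2 y1 y2 z a1 a2 a3 b1 b2 b3 c1 c2 c3 :
    deficit x1 x2 y1 y2 z a1 a2 a3 b1 b2 b3 c1 c2 c3 =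
    deficit x2 x1 y2 y1 z a1 a3 a2 b1 b3 b2 c1 c3 c2.
  by rewrite /deficit; ring.
(* Stated by contradiction, the claim transports along transpositions of the terminals, which
   reduces it to sorted [B] values. *)
pose Q (a1 a2 a3 b1 b2 b3 c1 c2 c3 d1 d2 d3 e1 e2 e3 f1 f2 f3 : R) :=
  profile a1 a2 a3 b1 b2 b3 c1 c2 c3 -> profile d1 d2 d3 e1 e2 e3 f1 f2 f3 ->
  deficit a2 a3 b2 b3 c1 d1 d2 d3 e1 e2 e3 f1 f2 f3 < 0 ->
  deficit a1 a3 b1 b3 c2 d2 d1 d3 e2 e1 e3 f2 f1 f3 < 0 ->
  deficit a1 a2 b1 b2 c3 d3 d1 d2 e3 e1 e2 f3 f1 f2 < 0 -> False.
suff main : Q q1 q2 q3 r1 r2 r3 s1 s2 s3 u1 u2 u3 v1 v2 v3 w1 w2 w3.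
  move=> pq pu; have := main pq pu; rewrite !ltNge.
  case: (boolP (0 <= _)) => [|_]; first by constructor.
  case: (boolP (0 <= _)) => [|_]; first by constructor.
  case: (boolP (0 <= _)) => [|_]; first by constructor.
  by move=> /(_ isT isT isT).
have swap12 a1 a2 a3 b1 b2 b3 c1 c2 c3 d1 d2 d3 e1 e2 e3 f1 f2 f3 :
    Q a1 a2 a3 b1 b2 b3 c1 c2 c3 d1 d2 d3 e1 e2 e3 f1 f2 f3 ->
    Q a2 a1 a3 b2 b1 b3 c2 c1 c3 d2 d1 d3 e2 e1 e3 f2 f1 f3.
  move=> h /profile_swap12 pa /profile_swap12 pd D2 D1; rewrite sw => D3.
  exact: h.
have swap23 a1 a2 a3 b1 b2 b3 c1 c2 c3 d1 d2 d3 e1 e2 e3 f1 f2 f3 :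
    Q a1 a2 a3 b1 b2 b3 c1 c2 c3 d1 d2 d3 e1 e2 e3 f1 f2 f3 ->
    Q a1 a3 a2 b1 b3 b2 c1 c3 c2 d1 d3 d2 e1 e3 e2 f1 f3 f2.
  move=> h /profile_swap23 pa /profile_swap23 pd; rewrite sw => D1 D3 D2.
  exact: h.
have sorted a1 a2 a3 b1 b2 b3 c1 c2 c3 d1 d2 d3 e1 e2 e3 f1 f2 f3 :
    d1 + e1 - f1 <= d2 + e2 - f2 -> d2 + e2 - f2 <= d3 + e3 - f3 ->
    Q a1 a2 a3 b1 b2 b3 c1 c2 c3 d1 d2 d3 e1 e2 e3 f1 f2 f3.
  move=> B12 B23 pa pd; have [g1 g23] := profile_sorted_signs pd B12 B23.
  rewrite /deficit [_ - d2 - d1]addrAC ![_ - d3 - _]addrAC.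
  exact: some_deficit_ge0_signs pa B12 B23 g1 g23.
have [B12|/ltW B21] := leP (u1 + v1 - w1) (u2 + v2 - w2);
  have [B23|/ltW B32] := leP (u2 + v2 - w2) (u3 + v3 - w3);
  have [B13|/ltW B31] := leP (u1 + v1 - w1) (u3 + v3 - w3).
- exact: sorted.
- exact: sorted.
- exact/swap23/sorted.
- exact/swap23/swap12/sorted.
- exact/swap12/sorted.
- exact/swap12/swap23/sorted.
- exact/swap12/swap23/swap12/sorted.
- exact/swap12/swap23/swap12/sorted.
Qed.
End Algebra.

(** * Product measures on subsets of a finite type *)

Section Expect.
Variables (R : realFieldType) (T : finType) (p : T -> R).
Implicit Types (E w : {set T}) (F G : {set T} -> R) (P Q : pred {set T}).

(** Real-valued [F] instead of events: the differences of probabilities studied later are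
    expectations of signed bilinear forms in indicators. *)
Definition expect E F : R :=
  \sum_(w : {set T} | w \subset E)
    ((\prod_(e in w) p e) * \prod_(e in E :\: w) (1 - p e)) * F w.

Definition prob E P : R := expect E (fun w => (P w)%:R).

Lemma eq_expect E F G : (forall w, w \subset E -> F w = G w) ->
  expect E F = expect E G.
Proof. by move=> FG; apply: eq_bigr => w wE; rewrite FG. Qed.

Lemma expect_set0 F : expect set0 F = F set0.
Proof.
rewrite /expect (eq_bigl (pred1 set0)) => [|w]; last by rewrite subset0.
by rewrite big_pred1_eq setD0 !big_set0 !mul1r.
Qed.

(** Conditioning on whether [e] is open; later inductions on expectations rest on this identity. *)
Lemma expect_setU1 e E F : e \notin E -> expect (e |: E) F =
  p e * expect E (fun w => F (e |: w)) + (1 - p e) * expect E F.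
Proof.
move=> eE; rewrite /expect (bigID (fun w : {set T} => e \in w)) /=; congr (_ + _).
  rewrite (reindex_onto (fun w => e |: w) (fun w => w :\ e)) /=; last first.
    by move=> w /andP[_ ew]; rewrite setD1K.
  rewrite mulr_sumr; apply: eq_big => [w|w wE].
    rewrite setU11 andbT; apply/andP/idP => [[ewE /eqP eqw]|wE].
      rewrite -eqw; apply/subsetP => x; rewrite !inE => /andP[xe].
      by rewrite (negbTE xe) => /= xw; have := subsetP ewE x;
        rewrite !inE (negbTE xe) xw => /(_ isT).
    by rewrite setUS // setU1K //; apply: contra eE; exact: (subsetP wE).
  case/andP: wE => /andP[wE _] /eqP eqw.
  have ew : e \notin w by rewrite -eqw setD11.
  rewrite big_setU1 //= !mulrA; congr (_ * _ * _).
  apply: eq_bigl => x; rewrite !inE.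
  by have [->|] := eqVneq x e; rewrite ?(negbTE eE) ?andbF.
rewrite mulr_sumr; apply: eq_big => [w|w /andP[wE ew]].
  apply/andP/idP => [[wE ew]|wE].
    apply/subsetP => x xw; have := subsetP wE x xw; rewrite !inE.
    by case/orP=> // /eqP xe; rewrite -xe xw in ew.
  split; first by rewrite (subset_trans wE) ?subsetUr.
  by apply: contra eE; exact: (subsetP wE).
have -> : (e |: E) :\: w = e |: (E :\: w).
  by apply/setP=> x; rewrite !inE; have [->|] := eqVneq x e; rewrite ?ew.
rewrite big_setU1 ?inE ?(negbTE eE) ?andbF //=.
by rewrite !mulrA [_ * (1 - p e)]mulrC.
Qed.

Lemma finset_ind (K : {set T} -> Prop) : K set0 ->
  (forall e E, e \notin E -> K E -> K (e |: E)) -> forall E, K E.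
Proof.
move=> K0 K1 E; have [n] := ubnP #|E|; elim: n E => // n IH E.
have [->//|[e eE]] := set_0Vmem E; rewrite -(setD1K eE) cardsU1 setD11 add1n ltnS.
move=> cE; apply: K1; first by rewrite setD11.
exact: IH.
Qed.

Lemma expectD E F G :
  expect E (fun w => F w + G w) = expect E F + expect E G.
Proof. by rewrite -big_split; apply: eq_bigr => w _; rewrite mulrDr. Qed.

Lemma expectN E F : expect E (fun w => - F w) = - expect E F.
Proof. by rewrite /expect -sumrN; apply: eq_bigr => w _; rewrite mulrN. Qed.

Lemma expectB E F G :
  expect E (fun w => F w - G w) = expect E F - expect E G.
Proof. by rewrite expectD expectN. Qed.

Lemma expectZ E a F : expect E (fun w => a * F w) = a * expect E F.
Proof. by rewrite /expect mulr_sumr; apply: eq_bigr => w _; rewrite mulrCA. Qed.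

Lemma expectZr E a F : expect E (fun w => F w * a) = expect E F * a.
Proof. by rewrite /expect mulr_suml; apply: eq_bigr => w _; rewrite mulrA. Qed.

Lemma expect_cst E a : expect E (fun=> a) = a.
Proof.
elim/finset_ind: E => [|e E eE IH]; first by rewrite expect_set0.
by rewrite expect_setU1 // IH; ring.
Qed.

(** Independence of disjoint edge sets, in the form of Fubini's theorem. *)
Lemma expect_setU E1 E2 F : [disjoint E1 & E2] ->
  expect (E1 :|: E2) F =
  expect E1 (fun w1 => expect E2 (fun w2 => F (w1 :|: w2))).
Proof.
elim/finset_ind: E1 F => [|e E eE IH] F.
  move=> _; rewrite set0U expect_set0.
  by apply: eq_expect => w _; rewrite set0U.
rewrite disjoints_subset => dE.
have eE2 : e \notin E2.
  by have := subsetP dE e (setU11 _ _); rewrite inE.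
have dE' : [disjoint E & E2].
  by rewrite disjoints_subset (subset_trans _ dE) // subsetUr.
rewrite -setUA expect_setU1; last by rewrite inE negb_or eE.
rewrite !IH // expect_setU1 //; congr (_ * _ + _).
by apply: eq_expect => w1 _; apply: eq_expect => w2 _; rewrite setUA.
Qed.

Definition probability_on E := forall e, e \in E -> 0 <= p e <= 1.

Lemma probability_on_sub E1 E2 :
  E1 \subset E2 -> probability_on E2 -> probability_on E1.
Proof. by move=> E12 pE e /(subsetP E12); apply: pE. Qed.

Lemma le_expect E F G : probability_on E ->
  (forall w, w \subset E -> F w <= G w) -> expect E F <= expect E G.
Proof.
move=> pE FG; apply: ler_sum => w wE; apply: ler_wpM2l; last exact: FG.
apply: mulr_ge0; apply: prodr_ge0 => e.
  by move/(subsetP wE)/pE/andP => [].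
by rewrite inE => /andP[_ /pE/andP[_]]; rewrite subr_ge0.
Qed.

Lemma prob_ge0 E P : probability_on E -> 0 <= prob E P.
Proof.
move=> pE; rewrite -(expect_cst E 0); apply: le_expect => // w _.
Qed.

Lemma le_prob E P Q : probability_on E ->
  (forall w, w \subset E -> P w -> Q w) -> prob E P <= prob E Q.
Proof.
move=> pE PQ; apply: le_expect => // w wE; rewrite ler_nat.
by case: (P w) (PQ w wE) => // ->.
Qed.

Lemma eq_prob E P Q : (forall w, w \subset E -> P w = Q w) ->
  prob E P = prob E Q.
Proof. by move=> PQ; apply: eq_expect => w /PQ ->. Qed.

Lemma prob_pred0 E P : (forall w, w \subset E -> ~~ P w) -> prob E P = 0.
Proof.
move=> P0; rewrite -[RHS](expect_cst E); apply: eq_expect => w /P0.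
by case: (P w).
Qed.

Definition shift e P : pred {set T} := fun w => P (e |: w).

Lemma prob_setU1 e E P : e \notin E -> prob (e |: E) P =
  p e * prob E (shift e P) + (1 - p e) * prob E P.
Proof. exact: expect_setU1. Qed.

Lemma probC E P : prob E (predC P) = 1 - prob E P.
Proof.
rewrite -(expect_cst E 1) -expectB; apply: eq_expect => w _ /=.
by case: (P w) => /=; rewrite ?subrr ?subr0.
Qed.

Definition both P Q : pred {set T} := fun w => P w && Q w.

Definition increasing P := forall e w, P w -> P (e |: w).

(** Conditioning on one element leaves, besides the inductive bounds on both halves, the term p
    (1-p)(x1 - x0)(y1 - y0), nonnegative by monotonicity. *)
Lemma harris E P Q : probability_on E -> increasing P -> increasing Q ->
  prob E P * prob E Q <= prob E (both P Q).
Proof.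
elim/finset_ind: E P Q => [|e E eE IH] P Q pE incP incQ.
  by rewrite /prob !expect_set0 /= -natrM mulnb.
have pE' := probability_on_sub (subsetUr [set e] E) pE.
have /andP[p0 p1] := pE e (setU11 _ _).
have incU S : increasing S -> increasing (shift e S).
  by move=> incS e' w; rewrite /shift setUCA; apply: incS.
rewrite !prob_setU1 //.
have i0 := IH _ _ pE' incP incQ.
have i1 := IH _ _ pE' (incU _ incP) (incU _ incQ).
have mon S : increasing S -> prob E S <= prob E (shift e S).
  by move=> incS; apply: le_prob => // w _; apply: incS.
have := mon _ incP; have := mon _ incQ.
rewrite -[prob E (both _ _)]/(prob E (shift e (both P Q))) in i1.
move: i0 i1; set x0 := prob E P; set y0 := prob E Q.
set x1 := prob E (shift e P); set y1 := prob E (shift e Q).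
move=> i0 i1 hy hx.
have : 0 <= (p e * (1 - p e)) * ((x1 - x0) * (y1 - y0)).
  by rewrite !mulr_ge0 ?subr_ge0.
have := ler_wpM2l p0 i1; have := ler_wpM2l (_ : 0 <= 1 - p e) i0.
rewrite subr_ge0 => /(_ p1); lra.
Qed.

(** Inclusion-exclusion reduces decreasing events to increasing ones. *)
Lemma harris_predC E P Q : probability_on E -> increasing P -> increasing Q ->
  prob E (predC P) * prob E (predC Q) <= prob E (both (predC P) (predC Q)).
Proof.
move=> pE incP incQ; have := harris pE incP incQ.
suff -> : prob E (both (predC P) (predC Q)) =
    1 - prob E P - prob E Q + prob E (both P Q) by rewrite !probC; lra.
rewrite -(expect_cst E 1) -!expectB -expectD; apply: eq_expect => w _.
by rewrite /both /=; case: (P w); case: (Q w) => /=; ring.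
Qed.
End Expect.

(** * Connectivity and clusters *)

Section Connectivity.
Variable V : finType.
Implicit Types (x y v n : V) (e : {set V}) (w E : {set {set V}}) (X Y T : {set V}).
Implicit Types (f g : pred {set {set V}}).

Lemma open_adj_sym w : symmetric (open_adj w).
Proof. by move=> x y; rewrite /open_adj setUC. Qed.

Lemma connected_sym w x y : connected x y w = connected y x w.
Proof. by rewrite /connected (sym_connect_sym (open_adj_sym w)). Qed.

Lemma connected_refl w x : connected x x w.
Proof. exact: connect0. Qed.

Lemma connected_trans w x y z :
  connected x y w -> connected y z w -> connected x z w.
Proof. exact: connect_trans. Qed.

Lemma connected_triangle w x y z :
  [&& connected x y w && connected y z w ==> connected x z w,
      connected x y w && connected x z w ==> connected y z w &
      connected x z w && connected y z w ==> connected x y w].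
Proof.
apply/and3P; split; apply/implyP => /andP[a b].
- exact: connected_trans a b.
- by apply: connected_trans b; rewrite connected_sym.
- by apply: connected_trans a _; rewrite connected_sym.
Qed.

Lemma connected_sub w1 w2 x y :
  w1 \subset w2 -> connected x y w1 -> connected x y w2.
Proof.
move=> w12; apply: connect_sub => a b ab.
by apply: connect1; apply: (subsetP w12).
Qed.

Lemma connected_ind w (K : pred V) x y :
  (forall a b, [set a; b] \in w -> K a -> K b) ->
  connected x y w -> K x -> K y.
Proof.
move=> Kstep /connectP[q]; elim: q x => [|a q IH] x /=; first by move=> _ ->.
by move=> /andP[xa qa] yE Kx; apply: IH qa yE _; apply: Kstep xa Kx.
Qed.

(** A path can be shortened to cross the new edge at most once, in either direction. *)
Lemma connected_setU1 w x y v n : connected x y ([set v; n] |: w) =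
  [|| connected x y w, connected x v w && connected n y w |
      connected x n w && connected v y w].
Proof.
have inc := connected_sub (subsetUr [set [set v; n]] w).
have vn : connected v n ([set v; n] |: w).
  by apply: connect1; rewrite /open_adj setU11.
apply/idP/or3P => [xy|[xy|/andP[xv ny]|/andP[xn vy]]].
- pose K a := [|| connected x a w, connected x v w && connected n a w |
      connected x n w && connected v a w].
  suff : K y by move/or3P.
  apply: connected_ind xy _; last by rewrite /K connected_refl.
  move=> a b; rewrite in_setU1 => /orP[/eqP/setP vnE|ab].
    have : (a == v) || (a == n) by have := vnE a; rewrite !inE eqxx.
    have : (b == v) || (b == n) by have := vnE b; rewrite !inE eqxx orbT.
    rewrite /K => /orP[]/eqP -> /orP[]/eqP ->; rewrite !connected_refl ?andbT //.
    + by case/or3P => [->|->|/andP[-> _]] //; rewrite ?orbT.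
    + by case/or3P => [->|/andP[-> _]|->] //; rewrite ?orbT.
  have st z : connected z a w -> connected z b w.
    by move=> za; apply: connected_trans za (connect1 _).
  by case/or3P => [/st|/andP[xv /st na]|/andP[xn /st va]]; rewrite /K;
    [move->|rewrite xv na orbT|rewrite xn va !orbT].
- exact: inc.
- by apply: connected_trans (inc _ _ xv) (connected_trans vn (inc _ _ ny)).
- apply: connected_trans (inc _ _ xn) (connected_trans _ (inc _ _ vy)).
  by rewrite connected_sym.
Qed.

Lemma connected_increasing x y : increasing (@connected V x y).
Proof. by move=> e w; apply: connected_sub; apply: subsetUr. Qed.

(** Fails as soon as X and T meet, since a vertex is connected to itself. *)
Definition sep X T w := [forall x in X, forall t in T, ~~ connected x t w].

Lemma sepP X T w :
  reflect (forall x t, x \in X -> t \in T -> ~~ connected x t w) (sep X T w).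
Proof.
apply: (iffP forall_inP) => [h x t xX tT|h x xX].
  by have /forall_inP := h _ xX; apply.
by apply/forall_inP => t; apply: h.
Qed.

Lemma sepC X T w : sep X T w = sep T X w.
Proof.
by apply/sepP/sepP => h x t xX tT; rewrite connected_sym h.
Qed.

Lemma sep_sub X1 X2 T1 T2 w1 w2 : X1 \subset X2 -> T1 \subset T2 ->
  w1 \subset w2 -> sep X2 T2 w2 -> sep X1 T1 w1.
Proof.
move=> X12 T12 w12 /sepP h; apply/sepP => x t xX tT.
by apply: contra (h x t (subsetP X12 _ xX) (subsetP T12 _ tT)); apply: connected_sub.
Qed.

(** Exploration step: v is already a source, so opening vn makes n a source too. *)
Lemma sep_setU1 X T w v n : v \in X ->
  sep X T ([set v; n] |: w) = sep (n |: X) T w.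
Proof.
move=> vX; apply/sepP/sepP => h x t.
  rewrite in_setU1 => /orP[/eqP ->|xX] tT; last first.
    by have := h x t xX tT; rewrite connected_setU1 negb_or => /andP[].
  have := h v t vX tT; rewrite connected_setU1 !negb_or connected_refl /=.
  by case/and3P.
move=> xX tT; rewrite connected_setU1 !negb_or !negb_and.
rewrite (h x t) ?(h n t) ?(h v t) ?orbT // ?setU11 //.
  by rewrite in_setU1 vX orbT.
by rewrite in_setU1 xX orbT.
Qed.

(* Members of w that are not of the form [set v; n] play no role. *)
Definition avoids X e w := forall x v n, x \in X -> e = [set v; n] ->
  ~~ connected x v w /\ ~~ connected x n w.

(* The event f depends only on the open edges in the clusters of X. *)
Definition local X f := forall e w, avoids X e w -> f (e |: w) = f w.

Lemma local_sub X Y f : X \subset Y -> local X f -> local Y f.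
Proof.
by move=> XY lf e w av; apply: lf => x v n xX; apply: av; apply: (subsetP XY).
Qed.

Lemma open_adj_junk e w : (forall v n, e <> [set v; n]) ->
  open_adj (e |: w) =2 open_adj w.
Proof.
move=> je v n; rewrite /open_adj in_setU1.
by case: eqP => // /esym /je.
Qed.

Lemma local_connected X x y : x \in X -> local X (connected x y).
Proof.
move=> xX e w av.
have [/existsP[[v n] /= /eqP eE]|je] := boolP [exists u : V * V, e == [set u.1; u.2]].
  have [xv xn] := av _ _ _ xX eE.
  by rewrite eE connected_setU1 (negbTE xv) (negbTE xn) !orbF.
rewrite /connected; apply: eq_connect; apply: open_adj_junk => v n eE.
by move/existsP: je; apply; exists (v, n); rewrite eE.
Qed.

Lemma avoids_sep X T v n w : v \in X -> sep (n |: X) T w -> avoids T [set v; n] w.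
Proof.
move=> vX /sepP h t a b tT /setP eE.
have av : (a == v) || (a == n) by have := eE a; rewrite !inE eqxx.
have bv : (b == v) || (b == n) by have := eE b; rewrite !inE eqxx orbT.
have hh c : (c == v) || (c == n) -> ~~ connected t c w.
  by case/orP => /eqP ->; rewrite connected_sym h ?setU11 // in_setU1 vX orbT.
by split; apply: hh.
Qed.

Lemma shift_increasing e f : increasing f -> increasing (shift e f).
Proof. by move=> If e' w; rewrite /shift setUCA; apply: If. Qed.

(** The clusters of X after opening vn are covered by those of [n |: X] before, so an edge avoiding
    the latter avoids the former. *)
Lemma shift_local X v n f : v \in X -> local X f ->
  local (n |: X) (shift [set v; n] f).
Proof.
move=> vX lf e w av; rewrite /shift setUCA lf // => x a b xX eE.
have [na nb] := av n a b (setU11 n X) eE.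
have [xa xb] := av x a b (setU1r n xX) eE.
have [va vb] := av v a b (setU1r n vX) eE.
by rewrite !connected_setU1 !negb_or !negb_and na nb xa xb va vb !orbT.
Qed.

(** Increasing functions of the clusters of X, as in the van den Berg-Haggstrom-Kahn inequalities.
    The class is stable under opening an edge at a source once its other end becomes a source. *)
Definition cluster_event X f := increasing f /\ local X f.

Lemma cluster_event_sub X Y f :
  X \subset Y -> cluster_event X f -> cluster_event Y f.
Proof. by move=> XY [If /(local_sub XY)]. Qed.

Lemma cluster_eventT X : cluster_event X predT.
Proof. by []. Qed.

Lemma cluster_eventI X Y f g : cluster_event X f -> cluster_event Y g ->
  cluster_event (X :|: Y) (both f g).
Proof.
move=> /(cluster_event_sub (subsetUl X Y))[If lf].
move=> /(cluster_event_sub (subsetUr X Y))[Ig lg]; split=> [e w|e w av].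
  by case/andP=> fw gw; apply/andP; split; [apply: If|apply: Ig].
by rewrite /both lf ?lg.
Qed.

Lemma cluster_event_connected X x y : x \in X -> cluster_event X (connected x y).
Proof. by move=> xX; split; [apply: connected_increasing|apply: local_connected]. Qed.

Lemma cluster_event_shift X v n f : v \in X -> cluster_event X f ->
  cluster_event (n |: X) (shift [set v; n] f).
Proof. by move=> vX [If lf]; split; [apply: shift_increasing|apply: shift_local]. Qed.

(** Without edges at X, the clusters of X stay inside X; this settles the end of the exploration. *)
Lemma avoids_isolated X E w e :
  (forall v n, v \in X -> [set v; n] \notin E) -> e \in E -> w \subset E ->
  avoids X e w.
Proof.
move=> iso eE wE x v n xX eV.
have K y : connected x y w -> y \in X.
  move=> xy; apply: connected_ind xy xX => a b ab aX.
  by have := iso a b aX; rewrite (subsetP wE).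
split; apply/negP => /K vX; have := iso _ _ vX.
  by move/(_ n); rewrite -eV eE.
by move/(_ v); rewrite setUC -eV eE.
Qed.

Lemma local_isolated X E f w :
  (forall v n, v \in X -> [set v; n] \notin E) -> local X f -> w \subset E ->
  f w = f set0.
Proof.
move=> iso lf; elim/finset_ind: w => // e w ew IH; rewrite subUset sub1set.
by case/andP => eE wE; rewrite lf ?IH //; apply: avoids_isolated eE wE.
Qed.

Lemma sep_isolated X T E w :
  (forall v n, v \in X -> [set v; n] \notin E) -> w \subset E ->
  sep X T w = [disjoint X & T].
Proof.
move=> iso wE; apply/sepP/idP => [h|dXT x t xX tT].
  apply/pred0P => x /=; apply/negbTE/negP => /andP[xX xT].
  by have := h x x xX xT; rewrite connected_refl.
apply/negP => xt; have : t \in X.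
  apply: connected_ind xt xX => a b ab aX.
  by have := iso a b aX; rewrite (subsetP wE).
by move=> tX; have := pred0P dXT t; rewrite /= tX tT.
Qed.

Lemma touching_edge X (E : {set {set V}}) :
  (exists2 e, e \in E & exists2 v, v \in X & exists n, e = [set v; n]) \/
  (forall v n, v \in X -> [set v; n] \notin E).
Proof.
have [/exists_inP[v vX /existsP[n vnE]]|no] :=
    boolP [exists v in X, exists n, [set v; n] \in E].
  by left; exists [set v; n] => //; exists v => //; exists n.
right=> v n vX; apply: contra no => vnE.
by apply/exists_inP; exists v => //; apply/existsP; exists n.
Qed.
End Connectivity.

(** * Correlation of separated clusters *)

Section ClusterInequalities.
Variables (R : realFieldType) (V : finType) (p : {set V} -> R).
Implicit Types (E : {set {set V}}) (X T : {set V}) (f g : pred {set {set V}}).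

Definition sep_event X T f g : pred {set {set V}} :=
  fun w => [&& sep X T w, f w & g w].

(** Opening vn adds n to the sources and leaves [g] unchanged, because under separation this edge
    avoids the clusters of T. *)
Lemma prob_setU1_sep v n E X T f g : v \in X -> [set v; n] \notin E ->
  local T g ->
  prob p ([set v; n] |: E) (sep_event X T f g) =
  p [set v; n] * prob p E (sep_event (n |: X) T (shift [set v; n] f) g)
  + (1 - p [set v; n]) * prob p E (sep_event X T f g).
Proof.
move=> vX vnE lg; rewrite prob_setU1 //; congr (_ * _ + _).
apply: eq_prob => w _; rewrite /shift /sep_event sep_setU1 //.
by have [sw|//] := boolP (sep (n |: X) T w); rewrite (lg _ _ (avoids_sep vX sw)).
Qed.

Lemma prob_sepC E X T f g :
  prob p E (sep_event X T f g) = prob p E (sep_event T X g f).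
Proof. by apply: eq_prob => w _; rewrite /sep_event sepC [f w && _]andbC. Qed.

(* Under separation the clusters of X and T use disjoint sets of open edges, so
   this is an instance of the van den Berg-Kesten inequality. *)
Lemma prob_sep_le E X T f g : probability_on p E ->
  cluster_event X f -> cluster_event T g ->
  prob p E (sep_event X T f g) <= prob p E f * prob p E g.
Proof.
have [m] := ubnP #|E|; elim: m E X f g => // m IH E X f g.
rewrite ltnS => cE pE [If lf] [Ig lg].
have [[e eE [v vX [n en]]]|iso] := touching_edge X E; last first.
  have f0 w := local_isolated (w := w) iso lf.
  have -> : prob p E f = (f set0)%:R.
    by rewrite -[RHS](expect_cst p E); apply: eq_expect => w /f0 ->.
  rewrite -[_ * prob p E g]expectZ; apply: le_expect => // w wE.
  rewrite /sep_event f0 // -natrM mulnb ler_nat.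
  by case: (sep X T w).
have eE' : e \notin E :\ e by rewrite setD11.
have pE' := probability_on_sub (subsetDl E [set e]) pE.
have /andP[p0 p1] := pE e eE.
have cE' : (#|E :\ e| < m)%N by move: cE; rewrite (cardsD1 e E) eE.
rewrite -(setD1K eE); move: (E :\ e) eE' pE' cE' => {eE cE pE} E eE pE cE.
have gle : prob p E g <= prob p (e |: E) g.
  rewrite prob_setU1 // -lerBlDr.
  have : prob p E g <= prob p E (shift e g).
    by apply: le_prob => // w _; apply: Ig.
  by move=> /(ler_wpM2l p0); rewrite mulrBl mul1r opprB addrC subrK.
have q0 : 0 <= 1 - p e by rewrite subr_ge0.
(* The revealed edge is charged to [f] alone; [g] stays on E, where it is no more likely than on
   [e |: E]. *)
apply: le_trans (_ : _ <= prob p (e |: E) f * prob p E g) _; last first.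
  apply: ler_wpM2l gle; rewrite prob_setU1 //.
  by rewrite addr_ge0 // mulr_ge0 // prob_ge0.
rewrite {1}en prob_setU1_sep -?en // prob_setU1 //.
rewrite [leRHS]mulrDl -!mulrA.
apply: lerD; apply: ler_wpM2l => //; last exact: IH.
by apply: IH => //; rewrite en; apply: cluster_event_shift.
Qed.

(** With X1 = X2 and T1 = T2 this contains the correlations given separation: positive for two
    events of one side, negative for events of opposite sides. Distinct sources are allowed because
    the mixed terms of an edge revelation enlarge only one of X1 and X2. *)
Definition cluster_inequality E X1 X2 T1 T2 f1 f2 g1 g2 :=
  prob p E (sep_event X1 T1 f1 g1) * prob p E (sep_event X2 T2 f2 g2) <=
  prob p E (sep_event (X1 :|: X2) (T1 :&: T2) (both f1 f2) predT) *
  prob p E (sep_event (X1 :&: X2) (T1 :|: T2) predT (both g1 g2)).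

Lemma cluster_inequality_swap E X1 X2 T1 T2 f1 f2 g1 g2 :
  cluster_inequality E T1 T2 X1 X2 g1 g2 f1 f2 ->
  cluster_inequality E X1 X2 T1 T2 f1 f2 g1 g2.
Proof.
rewrite /cluster_inequality [leRHS]mulrC.
by rewrite ![prob p E (sep_event (_ :&: _) _ _ _)]prob_sepC
  ![prob p E (sep_event T1 _ _ _)]prob_sepC ![prob p E (sep_event T2 _ _ _)]prob_sepC
  [prob p E (sep_event (T1 :|: _) _ _ _)]prob_sepC.
Qed.

Definition cluster_inequality_on E := forall X1 X2 T1 T2 f1 f2 g1 g2,
  cluster_event X1 f1 -> cluster_event X2 f2 ->
  cluster_event T1 g1 -> cluster_event T2 g2 ->
  cluster_inequality E X1 X2 T1 T2 f1 f2 g1 g2.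

(* Opening the edge vn from v to n amounts to adding n to the sources, so the
   four-function inequality for one bit reduces the claim to the graph without
   this edge. *)
Lemma cluster_inequality_step E v n X1 X2 T1 T2 f1 f2 g1 g2 :
  [set v; n] \notin E -> probability_on p ([set v; n] |: E) ->
  cluster_inequality_on E -> v \in X1 :&: X2 ->
  cluster_event X1 f1 -> cluster_event X2 f2 ->
  cluster_event T1 g1 -> cluster_event T2 g2 ->
  cluster_inequality ([set v; n] |: E) X1 X2 T1 T2 f1 f2 g1 g2.
Proof.
move=> eE pE IH; rewrite in_setI => /andP[vX1 vX2] cf1 cf2 cg1 cg2.
have pE' := probability_on_sub (subsetUr _ E) pE.
have p01 := pE _ (setU11 _ _).
have [lg1 lg2] := (cg1.2, cg2.2).
have [_ lg12] := cluster_eventI cg1 cg2.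
have cs1 := cluster_event_shift n vX1 cf1.
have cs2 := cluster_event_shift n vX2 cf2.
rewrite /cluster_inequality !prob_setU1_sep //; first last.
- by rewrite in_setU vX1.
- by rewrite in_setI vX1.
have sub1 w : f1 w -> shift [set v; n] f1 w by apply: cf1.1.
have sub2 w : f2 w -> shift [set v; n] f2 w by apply: cf2.1.
have mono (A B C D : {set V}) (h h' k : pred {set {set V}}) :
    A \subset C -> B \subset D -> (forall w, h' w -> h w) ->
    prob p E (sep_event C D h' k) <= prob p E (sep_event A B h k).
  move=> AC BD hh; apply: le_prob => // w _ /and3P[sw hw kw].
  by rewrite /sep_event (sep_sub AC BD (subxx w)) // hh ?kw.
apply: four_functions_bit => //; try exact: prob_ge0.
- exact: IH.
- have := IH _ _ _ _ _ _ _ _ cs1 cs2 cg1 cg2.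
  by rewrite /cluster_inequality -setUUr -setUIr.
(* Mixed terms: n enters one of X1, X2, and the target has it in the union but not in the
   intersection; monotonicity in sources and events absorbs the difference. *)
- apply: le_trans (IH _ _ _ _ _ _ _ _ cs1 cf2 cg1 cg2) _.
  apply: ler_pM; rewrite ?prob_ge0 //; apply: mono => //.
  + by rewrite setUA.
  + by move=> w /andP[a b]; rewrite /shift /both; apply/andP; split=> //; apply: sub2.
  + by rewrite setSI // subsetUr.
- apply: le_trans (IH _ _ _ _ _ _ _ _ cf1 cs2 cg1 cg2) _.
  apply: ler_pM; rewrite ?prob_ge0 //; apply: mono => //.
  + by rewrite setUCA.
  + by move=> w /andP[a b]; rewrite /shift /both; apply/andP; split=> //; apply: sub1.
  + by rewrite setIS // subsetUr.
Qed.

Lemma prob_sep_overlap E X T f g : probability_on p E ->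
  ~~ [disjoint X & T] -> prob p E (sep_event X T f g) = 0.
Proof.
move=> pE /pred0Pn[x /andP[/= xX xT]]; apply: prob_pred0 => w _.
apply/negP => /and3P[/sepP h _ _].
by have := h x x xX xT; rewrite connected_refl.
Qed.

(** If the left side does not vanish by overlap, the separations on the right hold automatically,
    the common sources being isolated and disjoint from the opposite ones. [prob_sep_le] factorizes
    the left side, and Harris' inequality treats the [f] and the [g] apart. *)
Lemma cluster_inequality_isolated E X1 X2 T1 T2 f1 f2 g1 g2 :
  probability_on p E ->
  (forall v n, v \in X1 :&: X2 -> [set v; n] \notin E) ->
  (forall v n, v \in T1 :&: T2 -> [set v; n] \notin E) ->
  cluster_event X1 f1 -> cluster_event X2 f2 ->
  cluster_event T1 g1 -> cluster_event T2 g2 ->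
  cluster_inequality E X1 X2 T1 T2 f1 f2 g1 g2.
Proof.
move=> pE isoX isoT cf1 cf2 cg1 cg2; rewrite /cluster_inequality.
have rhs0 : 0 <= prob p E (sep_event (X1 :|: X2) (T1 :&: T2) (both f1 f2) predT) *
  prob p E (sep_event (X1 :&: X2) (T1 :|: T2) predT (both g1 g2)).
  by rewrite mulr_ge0 ?prob_ge0.
have [d1|nd1] := boolP [disjoint X1 & T1]; last by rewrite prob_sep_overlap ?mul0r.
have [d2|nd2] := boolP [disjoint X2 & T2]; last first.
  by rewrite [X in _ * X]prob_sep_overlap ?mulr0.
have dC : [disjoint T1 :&: T2 & X1 :|: X2].
  apply/pred0P => x /=; rewrite !inE; have := pred0P d1 x; have := pred0P d2 x => /=.
  by case: (x \in X1); case: (x \in X2); case: (x \in T1); case: (x \in T2).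
have dD : [disjoint X1 :&: X2 & T1 :|: T2].
  apply/pred0P => x /=; rewrite !inE; have := pred0P d1 x; have := pred0P d2 x => /=.
  by case: (x \in X1); case: (x \in X2); case: (x \in T1); case: (x \in T2).
have -> : prob p E (sep_event (X1 :|: X2) (T1 :&: T2) (both f1 f2) predT) =
    prob p E (both f1 f2).
  apply: eq_prob => w wE.
  by rewrite /sep_event sepC (sep_isolated _ isoT wE) dC andbT.
have -> : prob p E (sep_event (X1 :&: X2) (T1 :|: T2) predT (both g1 g2)) =
    prob p E (both g1 g2).
  by apply: eq_prob => w wE; rewrite /sep_event (sep_isolated _ isoX wE) dD.
apply: le_trans (ler_pM _ _ (prob_sep_le pE cf1 cg1) (prob_sep_le pE cf2 cg2)) _;
  rewrite ?prob_ge0 // mulrACA.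
apply: ler_pM; rewrite ?mulr_ge0 ?prob_ge0 //; apply: harris => //.
- exact: cf1.1.
- exact: cf2.1.
- exact: cg1.1.
- exact: cg2.1.
Qed.

Lemma cluster_inequality_valid E : probability_on p E -> cluster_inequality_on E.
Proof.
have [m] := ubnP #|E|; elim: m E => // m IH E cE pE.
have step e : e \in E ->
    [/\ e \notin E :\ e, probability_on p (e |: E :\ e) &
        cluster_inequality_on (E :\ e)].
  move=> eE; rewrite setD11 setD1K //; split=> //; apply: IH.
    by move: cE; rewrite (cardsD1 e E) eE ltnS.
  exact: probability_on_sub (subsetDl E _) pE.
move=> X1 X2 T1 T2 f1 f2 g1 g2 cf1 cf2 cg1 cg2.
have [[e eE [v vX [n en]]]|isoX] := touching_edge (X1 :&: X2) E.
  have [eE' pE' IHe] := step e eE.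
  rewrite -(setD1K eE); move: (E :\ e) eE' pE' IHe => E'; rewrite en => *.
  exact: cluster_inequality_step.
have [[e eE [v vT [n en]]]|isoT] := touching_edge (T1 :&: T2) E.
  have [eE' pE' IHe] := step e eE; apply: cluster_inequality_swap.
  rewrite -(setD1K eE); move: (E :\ e) eE' pE' IHe => E'; rewrite en => *.
  exact: cluster_inequality_step.
exact: cluster_inequality_isolated.
Qed.

End ClusterInequalities.

(** Brute force over the six connections among four vertices; the four triangles discard the truth
    values that come from no partition. *)
Ltac connected_cases w z i j k :=
  rewrite ?(connected_sym w i z) ?(connected_sym w j z) ?(connected_sym w k z)
    ?(connected_sym w j i) ?(connected_sym w k i) ?(connected_sym w k j);
  move: (connected_triangle w z i j) (connected_triangle w z i k)
    (connected_triangle w z j k) (connected_triangle w i j k);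
  move: (connected z i w) (connected z j w) (connected z k w) (connected i j w)
    (connected i k w) (connected j k w);
  do 6!case=> //=.

(** * Connection patterns of a root and three terminals *)

Section Patterns.
Variables (R : realFieldType) (V : finType) (p : {set V} -> R).
Implicit Types (E w : {set {set V}}) (z i j k : V).

(** In each pattern [i] is the distinguished terminal, [j] and [k] being interchangeable; relations
    implied by transitivity are not tested. *)
Definition pattern_q z i j k : pred {set {set V}} := fun w =>
  [&& connected z i w, ~~ connected i j w, ~~ connected i k w & ~~ connected j k w].

Definition pattern_r z i j k : pred {set {set V}} := fun w =>
  [&& connected z i w, connected j k w, ~~ connected i j w & ~~ connected i k w].

Definition pattern_s z i j k : pred {set {set V}} := fun w =>
  [&& connected z j w, connected j k w & ~~ connected i j w].

Lemma pattern_qC z i j k : pattern_q z i j k =1 pattern_q z i k j.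
Proof. by move=> w; rewrite /pattern_q; connected_cases w z i j k. Qed.

Lemma pattern_rC z i j k : pattern_r z i j k =1 pattern_r z i k j.
Proof. by move=> w; rewrite /pattern_r; connected_cases w z i j k. Qed.

Lemma pattern_sC z i j k : pattern_s z i j k =1 pattern_s z i k j.
Proof. by move=> w; rewrite /pattern_s; connected_cases w z i j k. Qed.

Lemma sep12 i j k w :
  sep [set i] [set j; k] w = ~~ connected i j w && ~~ connected i k w.
Proof.
apply/sepP/andP => [h|[ij ik] x t].
  by rewrite !h ?set11 // !inE eqxx ?orbT.
by rewrite !inE => /eqP-> /orP[]/eqP->.
Qed.

Lemma cluster_eventU X f g : cluster_event X f -> cluster_event X g ->
  cluster_event X (fun w : {set {set V}} => f w || g w).
Proof.
move=> [If lf] [Ig lg]; split=> [e w /orP[/(If e)->|/(Ig e)->]|e w av] //.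
  by rewrite orbT.
by rewrite lf ?lg.
Qed.

Section Profile.
Variables (E : {set {set V}}) (z i j k : V).
Hypothesis pE : probability_on p E.
Local Notation Pr := (prob p E).
Let N : pred {set {set V}} := fun w => ~~ connected i j w && ~~ connected i k w.

(** Negative correlation given [N]: z in the cluster of i, against j joined to k. *)
Lemma pattern_r_neg : Pr (pattern_r z i j k) * Pr N <=
  (Pr (pattern_r z i j k) + Pr (pattern_q z i j k)) *
  Pr (fun w => N w && connected j k w).
Proof.
have cz := cluster_event_connected z (set11 i).
have jT : j \in [set j; k] by rewrite set21.
have cjk := cluster_event_connected k jT.
have := cluster_inequality_valid pE cz (cluster_eventT [set i]) cjk
  (cluster_eventT [set j; k]).
rewrite /cluster_inequality !setUid !setIid.
rewrite -expectD.
congr (_ * _ <= _ * _); apply: eq_expect => w _;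
  rewrite /sep_event sep12 /pattern_r /pattern_q /N /both /=;
  by connected_cases w z i j k; rewrite ?addr0 ?add0r.
Qed.

(** Positive correlation given [N]: j joined to k, and z joined to {j, k}. *)
Lemma pattern_s_pos : Pr (fun w => N w && connected j k w) *
  (Pr (pattern_s z i j k) + (Pr (pattern_q z j i k) + Pr (pattern_q z k i j))) <=
  Pr N * Pr (pattern_s z i j k).
Proof.
have jT : j \in [set j; k] by rewrite set21.
have kT : k \in [set j; k] by rewrite set22.
have cjk := cluster_event_connected k jT.
have cT := cluster_eventU (cluster_event_connected z jT) (cluster_event_connected z kT).
have := cluster_inequality_valid pE (cluster_eventT [set i]) (cluster_eventT [set i])
  cjk cT.
rewrite /cluster_inequality !setUid !setIid.
rewrite -!expectD.
congr (_ * _ <= _ * _); apply: eq_expect => w _;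
  rewrite /sep_event sep12 /pattern_s /pattern_q /N /both /=;
  by connected_cases w z i j k; rewrite ?addr0 ?add0r.
Qed.

(** With n the probability of [N] and b that of [N] with j joined to k, put t = s + q_j + q_k. The
    two correlations chain to n r t <= (r + q) b t <= (r + q) n s; then n and r s cancel. *)
Lemma pattern_le : Pr (pattern_r z i j k) *
    (Pr (pattern_q z j i k) + Pr (pattern_q z k i j)) <=
  Pr (pattern_q z i j k) * Pr (pattern_s z i j k).
Proof.
have := pattern_r_neg; have := pattern_s_pos.
have n0 : 0 <= Pr N by rewrite prob_ge0.
have : Pr (pattern_r z i j k) <= Pr N.
  by apply: le_prob => // w _ /and4P[_ _ a b]; apply/andP.
have := prob_ge0 (pattern_r z i j k) pE; have := prob_ge0 (pattern_q z i j k) pE.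
have := prob_ge0 (pattern_s z i j k) pE; have := prob_ge0 (pattern_q z j i k) pE.
have := prob_ge0 (pattern_q z k i j) pE.
move: n0; set n := Pr N; set r := Pr (pattern_r _ _ _ _).
set q := Pr (pattern_q z i j k); set s := Pr (pattern_s _ _ _ _).
set q2 := Pr (pattern_q z j i k); set q3 := Pr (pattern_q z k i j).
set b := Pr (fun w => _).
move=> n0 q30 q20 s0 q0 r0 rn hs hr.
have [nz|nz] := eqVneq n 0.
  have -> : r = 0 by apply/eqP; rewrite eq_le r0 -nz rn.
  by rewrite mul0r mulr_ge0.
have npos : 0 < n by rewrite lt_def nz.
have k0 : 0 <= s + (q2 + q3) by rewrite !addr_ge0.
have h1 := ler_wpM2r k0 hr.
have h2 := ler_wpM2l (addr_ge0 r0 q0) hs.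
have : n * (r * (s + (q2 + q3))) <= n * ((r + q) * s).
  by move: h1 h2; clear; lra.
by rewrite ler_pM2l //; clear; lra.
Qed.

(** With q = 0, [pattern_r_neg] shows that r > 0 forces i|j|k to have probability 0. By Harris'
    inequality this probability bounds the product of those of i cut off from {j, k} and j cut off
    from {i, k}, which bound the two factors. *)
Lemma pattern_degenerate :
  Pr (pattern_q z i j k) = 0 ->
  Pr (pattern_r z i j k) * (Pr (pattern_r z j i k) + Pr (pattern_s z j i k)) = 0.
Proof.
move=> q0; have := pattern_r_neg; rewrite q0 addr0.
have := harris_predC pE (_ : increasing (fun w => connected i j w || connected i k w))
  (_ : increasing (fun w => connected j i w || connected j k w)).
have inc x y y' : increasing (fun w : {set {set V}} => connected x y w || connected x y' w).
  by move=> e w /orP[]/(connected_increasing e)->; rewrite ?orbT.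
move=> /(_ (inc _ _ _) (inc _ _ _)).
have -> : Pr N = Pr (fun w => N w && connected j k w) +
   Pr (fun w => N w && ~~ connected j k w).
  rewrite -expectD; apply: eq_expect => w _.
  by case: (N w); case: (connected j k w) => /=; rewrite ?addr0 ?add0r.
rewrite mulrDr gerDl => hh.
have : Pr (both (predC (fun w => connected i j w || connected i k w))
  (predC (fun w => connected j i w || connected j k w))) <=
  Pr (fun w => N w && ~~ connected j k w).
  apply: le_prob => // w _; rewrite /both /= /N !negb_or.
  by case/andP => -> /andP[_ ->].
move: hh; set pi := Pr (predC _); set pj := Pr (predC (fun w => connected j i w || _)).
set zeta := Pr (fun w => N w && ~~ _).
move=> h1 h2.
have ri : Pr (pattern_r z i j k) <= pi.
  by apply: le_prob => // w _ /and4P[_ _ a b] /=; rewrite negb_or a b.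
have rj : Pr (pattern_r z j i k) + Pr (pattern_s z j i k) <= pj.
  rewrite -expectD; apply: le_expect => // w _; rewrite -natrD ler_nat /=.
  rewrite /pattern_r /pattern_s; by connected_cases w z i j k.
have := prob_ge0 (pattern_r z i j k) pE; have := prob_ge0 (pattern_r z j i k) pE.
have := prob_ge0 (pattern_s z j i k) pE.
move: ri rj h1 h2; set r := Pr (pattern_r z i j k).
set r' := Pr (pattern_r z j i k); set s := Pr (pattern_s _ _ _ _).
move=> ri rj h1 h2 s0 r'0 r0 h3.
have [->|rn] := eqVneq r 0; first by rewrite mul0r.
have rpos : 0 < r by rewrite lt_def rn.
have hz : zeta <= 0 by move: h3; rewrite pmulr_rle0.
have rs0 : 0 <= r' + s by rewrite addr_ge0.
apply/eqP; rewrite eq_le mulr_ge0 // andbT.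
by apply: le_trans (ler_pM r0 rs0 ri rj) (le_trans h1 (le_trans h2 hz)).
Qed.
End Profile.

Lemma prob_patternC E z i j k :
  (prob p E (pattern_q z i j k) = prob p E (pattern_q z i k j)) *
  (prob p E (pattern_r z i j k) = prob p E (pattern_r z i k j)) *
  (prob p E (pattern_s z i j k) = prob p E (pattern_s z i k j)).
Proof.
by split; first split; apply: eq_prob => w _;
  rewrite (pattern_qC, pattern_rC, pattern_sC).
Qed.

Lemma percolation_profile E z i j k : probability_on p E ->
  profile (prob p E (pattern_q z i j k)) (prob p E (pattern_q z j i k))
    (prob p E (pattern_q z k i j)) (prob p E (pattern_r z i j k))
    (prob p E (pattern_r z j i k)) (prob p E (pattern_r z k i j))
    (prob p E (pattern_s z i j k)) (prob p E (pattern_s z j i k))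
    (prob p E (pattern_s z k i j)).
Proof.
move=> pE.
split; try by split; exact: prob_ge0.
- split; first exact: pattern_le.
    by have := pattern_le z j i k pE; rewrite (prob_patternC E z k j).
  have := pattern_le z k i j pE.
  by rewrite (prob_patternC E z i k) (prob_patternC E z j k).
- have := prob_ge0 (pattern_q z i j k) pE; have := prob_ge0 (pattern_q z j i k) pE.
  have := prob_ge0 (pattern_q z k i j) pE.
  move=> q3 q2 q1 /eqP; rewrite !paddr_eq0 ?addr_ge0 //.
  case/andP=> [/andP[/eqP q1z /eqP q2z] /eqP q3z].
  have d a b c := @pattern_degenerate E z a b c pE.
  split; split; first exact: d.
  + by have := d i k j; rewrite !(prob_patternC E z i k) => ->.
  + exact: d.
  + by have := d j k i; rewrite !(prob_patternC E z j k) !(prob_patternC E z k j) => ->.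
  + by have := d k i j; rewrite !(prob_patternC E z i k) => ->.
  + by have := d k j i; rewrite !(prob_patternC E z k j) !(prob_patternC E z j k) => ->.
Qed.
End Patterns.

(** * Gluing along a separating set *)

Section Gluing.
Variables (V : finType) (S A : {set V}) (w1 w2 : {set {set V}}).
Hypothesis w1_inside : forall x y, [set x; y] \in w1 -> (x \in S) || (x \in A).
Hypothesis w2_outside : forall x y, [set x; y] \in w2 -> x \notin S.
Local Notation w := (w1 :|: w2).

Lemma connected_inside a x :
  (a \in S) || (a \in A) -> connected a x w1 -> (x \in S) || (x \in A).
Proof.
move=> aSA ax; pose K x := (x \in S) || (x \in A).
apply: (connected_ind (K := K)) ax aSA => u v uv _; rewrite /K.
by apply: (w1_inside (y := u)); rewrite setUC.
Qed.

Lemma connected_outside a x : a \notin S -> connected a x w2 -> x \notin S.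
Proof.
move=> aS ax; pose K x := x \notin S; apply: (connected_ind (K := K)) ax aS.
by move=> u v uv _; apply: (w2_outside (y := u)); rewrite setUC.
Qed.

Lemma connected_glue1 x y : connected x y w1 -> connected x y w.
Proof. exact/connected_sub/subsetUl. Qed.

Lemma connected_glue2 x y : connected x y w2 -> connected x y w.
Proof. exact/connected_sub/subsetUr. Qed.

Lemma connected_edge (u : {set {set V}}) x y : [set x; y] \in u -> connected x y u.
Proof. exact: connect1. Qed.

Hypothesis SA0 : [disjoint S & A].

Let inA_notinS x : x \in A -> x \notin S.
Proof. by move=> xA; apply/negP => xS; have := pred0P SA0 x; rewrite /= xS xA. Qed.

(** A path changes sides only at vertices of A, where the closedness of [B] applies; so every vertex
    on it is reached from [B] within one side. *)
Lemma connected_closed (B : {set V}) a b : B \subset A ->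
  (forall x y, x \in B -> y \in A -> connected x y w1 || connected x y w2 -> y \in B) ->
  a \in B -> b \notin S -> connected a b w -> exists2 c, c \in B & connected c b w2.
Proof.
move=> BA Bcl aB bS ab.
pose K x := [exists c in B, connected c x w1 || connected c x w2].
have inB x c : c \in B -> x \in A -> connected c x w1 || connected c x w2 -> x \in B.
  by move=> cB xA; apply: Bcl.
have /exists_inP[c cB] : K b.
  apply: (connected_ind (K := K)) ab _; last first.
    by apply/exists_inP; exists a; rewrite // connected_refl.
  move=> x y xy /exists_inP[c cB cx]; have cA := subsetP BA c cB.
  have xB : x \notin S -> (x \in S) || (x \in A) -> x \in B.
    by move=> /negbTE -> /= xA; apply: inB cx.
  move: xy; rewrite in_setU => /orP[] xy; apply/exists_inP; case/orP: cx => cx.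
  - by exists c; rewrite // (connected_trans cx (connected_edge xy)).
  - exists x; last by rewrite (connected_edge xy).
    exact: xB (connected_outside (inA_notinS cA) cx) (w1_inside xy).
  - exists x; last by rewrite (connected_edge xy) orbT.
    by apply: xB (w2_outside xy) (connected_inside (a := c) _ cx); rewrite cA orbT.
  - by exists c; rewrite // (connected_trans cx (connected_edge xy)) orbT.
case/orP => cb; last by exists c.
exists b; last exact: connected_refl.
apply: (inB _ _ cB); last by rewrite cb.
have := connected_inside _ cb; rewrite (negbTE bS) /=; apply.
by rewrite (subsetP BA c cB) orbT.
Qed.

(** The first edge of a path that is not in [w1] starts outside S, hence in A. *)
Lemma connected_exit o x : o \in S -> connected o x w ->
  connected o x w1 \/ exists2 a, a \in A & connected o a w1 && connected a x w.
Proof.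
move=> oS ox.
pose K x := connected o x w1 || [exists a in A, connected o a w1 && connected a x w].
suff : K x by case/orP => [|/exists_inP]; [left|right].
apply: (connected_ind (K := K)) ox _; last by rewrite /K connected_refl.
move=> u v uv /orP[ou|/exists_inP[a aA /andP[oa au]]]; apply/orP; last first.
  right; apply/exists_inP; exists a; rewrite // oa.
  exact: connected_trans au (connected_edge uv).
have [uv1|uv1] := boolP ([set u; v] \in w1).
  by left; apply: connected_trans ou (connected_edge uv1).
right; apply/exists_inP; exists u; last by rewrite ou (connected_edge uv).
move: uv; rewrite in_setU (negbTE uv1) /= => /w2_outside/negbTE uS.
by have := connected_inside _ ou; rewrite uS oS; apply.
Qed.

Lemma connected_to_exit o : o \in S ->
  connected_to o A w = [exists a in A, connected o a w1].
Proof.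
move=> oS; apply/exists_inP/exists_inP => -[a aA oa]; last first.
  by exists a => //; apply: connected_glue1.
have [oa1|[c cA /andP[oc _]]] := connected_exit oS oa; first by exists a.
by exists c.
Qed.

Lemma connected_exitE o b : o \in S -> b \notin S ->
  connected o b w = [exists a in A, connected o a w1 && connected a b w].
Proof.
move=> oS bS; apply/idP/exists_inP => [ob|[a aA /andP[oa ab]]]; last first.
  exact: connected_trans (connected_glue1 oa) ab.
have [ob1|//] := connected_exit oS ob.
have bA : b \in A.
  by have := connected_inside _ ob1; rewrite oS (negbTE bS); apply.
by exists b; rewrite // ob1 connected_refl.
Qed.

Let m x y := connected x y w1 || connected x y w2.

Lemma connected_three i j k b : A = [set i; j; k] -> b \notin S ->
  connected i b w = [|| connected i b w2,
    (m i j || m i k && m k j) && connected j b w2 |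
    (m i k || m i j && m j k) && connected k b w2].
Proof.
move=> AE bS.
have glue x y : m x y -> connected x y w.
  by case/orP; [apply: connected_glue1|apply: connected_glue2].
apply/idP/or3P => [ib|].
  (* The closure of {i} under [m]: with three terminals, two steps suffice. *)
  pose B := [set a | [|| a == i, (a == j) && (m i j || m i k && m k j) |
    (a == k) && (m i k || m i j && m j k)]].
  have [] := @connected_closed B i b _ _ _ bS ib.
  - by apply/subsetP => a; rewrite AE !inE => /or3P[->|/andP[->]|/andP[->]];
      rewrite ?orbT.
  - move=> x y; rewrite AE !inE -/(m x y).
    case/or3P => [/eqP->|/andP[/eqP-> mx]|/andP[/eqP-> mx]];
      case/orP => [/orP[]|] /eqP-> mxy; rewrite ?eqxx ?orbT ?mxy ?mx ?orbT //.
    + case/orP: mx => [->|/andP[-> _]]; by rewrite ?orbT.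
    + case/orP: mx => [->|/andP[-> _]]; by rewrite ?orbT.
  - by rewrite inE eqxx.
  move=> a; rewrite inE => /or3P[/eqP->|/andP[/eqP->]|/andP[/eqP->]].
  - by constructor 1.
  - by move=> -> ab; constructor 2.
  - by move=> -> ab; constructor 3.
case=> [|/andP[mm]|/andP[mm]] /connected_glue2 //; apply: connected_trans.
- by case/orP: mm => [/glue //|/andP[/glue ik /glue]]; apply: connected_trans.
- by case/orP: mm => [/glue //|/andP[/glue ij /glue]]; apply: connected_trans.
Qed.
End Gluing.

Lemma exists_in_three (V : finType) (i j k : V) (P : pred V) :
  [exists a in [set i; j; k], P a] = [|| P i, P j | P k].
Proof.
apply/exists_inP/or3P => [[a]|].
  rewrite !inE => /orP[/orP[]|] /eqP-> Pa; by [constructor 1|constructor 2|constructor 3].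
by case=> Pa; eexists; try exact: Pa; rewrite !inE eqxx ?orbT.
Qed.

(** * The deficit as a bilinear form in pattern probabilities *)

Section Deficit.
Variables (R : realType) (V : finType).

(** Arbitrary [f] and [g] let one formula serve for indicators at fixed configurations and for
    probabilities. *)
Definition deficit_at (o b i j k : V) (f g : pred {set {set V}} -> R) : R :=
  deficit (f (pattern_q o j i k)) (f (pattern_q o k i j))
    (f (pattern_r o j i k)) (f (pattern_r o k i j)) (f (pattern_s o i j k))
    (g (pattern_q b i j k)) (g (pattern_q b j i k)) (g (pattern_q b k i j))
    (g (pattern_r b i j k)) (g (pattern_r b j i k)) (g (pattern_r b k i j))
    (g (pattern_s b i j k)) (g (pattern_s b j i k)) (g (pattern_s b k i j)).

(** Gluing expresses all events by connections within the two sides; the identity is then checked on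
    every pair of partitions. *)
Lemma deficit_indicator (S A : {set V}) (w1 w2 : {set {set V}}) (o b i j k : V) :
  (forall x y, [set x; y] \in w1 -> (x \in S) || (x \in A)) ->
  (forall x y, [set x; y] \in w2 -> x \notin S) ->
  [disjoint S & A] -> A = [set i; j; k] -> o \in S -> b \notin S ->
  (connected o b (w1 :|: w2) && connected_to o A (w1 :|: w2))%:R -
  (connected_to o A (w1 :|: w2) && connected i b (w1 :|: w2))%:R =
  deficit_at o b i j k (fun P => (P w1)%:R) (fun P => (P w2)%:R) :> R.
Proof.
move=> h1 h2 SA AE oS bS.
have AEj : A = [set j; i; k] by rewrite AE [[set i; j]]setUC.
have AEk : A = [set k; i; j] by rewrite AE setUC setUA.
rewrite (connected_exitE h1 h2 oS bS) (connected_to_exit h1 h2 oS) AE.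
rewrite !exists_in_three.
rewrite (connected_three h1 h2 SA AE bS) (connected_three h1 h2 SA AEj bS).
rewrite (connected_three h1 h2 SA AEk bS).
rewrite /deficit_at /deficit /pattern_q /pattern_r /pattern_s.
by connected_cases w1 o i j k; connected_cases w2 b i j k; move=> *; ring.
Qed.

Variable p : {set V} -> R.

Lemma expect_deficit (E1 E2 : {set {set V}}) (o b i j k : V) :
  expect p E1 (fun w1 => expect p E2 (fun w2 =>
    deficit_at o b i j k (fun P => (P w1)%:R) (fun P => (P w2)%:R))) =
  deficit_at o b i j k (prob p E1) (prob p E2).
Proof.
transitivity (expect p E1 (fun w1 =>
    deficit_at o b i j k (fun P => (P w1)%:R) (prob p E2))).
  apply: eq_expect => w1 _; rewrite /deficit_at /deficit.
  by rewrite !(expectD, expectN, expectZ).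
by rewrite /deficit_at /deficit !(expectD, expectN, expectZr).
Qed.

Lemma percolation_probE E (f : pred {set {set V}}) :
  percolation_prob E p f = prob p E f.
Proof.
rewrite /percolation_prob /prob /expect big_mkcondr; apply: eq_bigr => w _.
by case: (f w); rewrite ?mulr1 ?mulr0.
Qed.

Lemma separation_deficit (E1 E2 : {set {set V}}) (S A : {set V}) (o b i j k : V) :
  [disjoint E1 & E2] ->
  (forall x y, [set x; y] \in E1 -> (x \in S) || (x \in A)) ->
  (forall x y, [set x; y] \in E2 -> x \notin S) ->
  [disjoint S & A] -> A = [set i; j; k] -> o \in S -> b \notin S ->
  percolation_prob (E1 :|: E2) p [predI connected o b & connected_to o A] -
  percolation_prob (E1 :|: E2) p [predI connected_to o A & connected i b] =
  deficit_at o b i j k (prob p E1) (prob p E2).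
Proof.
move=> dE h1 h2 SA AE oS bS; rewrite !percolation_probE -expectB expect_setU //.
rewrite -expect_deficit; apply: eq_expect => w1 w1E; apply: eq_expect => w2 w2E.
rewrite -(@deficit_indicator S A) // => x y xy.
  by apply: (h1 x y); apply: (subsetP w1E).
by apply: (h2 x y); apply: (subsetP w2E).
Qed.
End Deficit.

(** * The side of [o] in the graph *)

Section Separation.
Variables (V : finType) (adj : rel V).
Implicit Types (A : {set V}) (o b x y : V).
Hypothesis adj_sym : symmetric adj.

Lemma in_edges x y : ([set x; y] \in edges adj) = adj x y.
Proof.
apply/imsetP/idP => [[[u v] /= uv /setP e]|xy]; last by exists (x, y); rewrite ?inE.
rewrite inE /= in uv.
have ex : (x == u) || (x == v) by have := e x; rewrite !inE eqxx => <-.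
have ey : (y == u) || (y == v) by have := e y; rewrite !inE eqxx orbT => <-.
have eu : (u == x) || (u == y) by have := e u; rewrite !inE eqxx => ->.
have ev : (v == x) || (v == y) by have := e v; rewrite !inE eqxx orbT => ->.
case/orP: ex eu ev => /eqP->; case/orP: ey => /eqP-> //; rewrite ?orbb.
- by move=> _ /eqP vu; rewrite -{2}vu.
- by rewrite adj_sym.
- by move=> /eqP uv' _; rewrite -{1}uv'.
Qed.

(** For [o] outside [A], the component of [o] in the graph with [A] deleted. *)
Definition side (A : {set V}) (o : V) : {set V} :=
  [set x | connect (fun x y => adj x y && (y \notin A)) o x].

Lemma side_disjoint A o : o \notin A -> [disjoint side A o & A].
Proof.
move=> oA; apply/pred0P => x /=; apply/negbTE/negP => /andP[].
rewrite inE => /connectP[q]; elim: q o oA => [|y q IH] o oA /=.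
  by move=> _ ->; apply/negP.
by case/andP=> /andP[_ yA]; apply: IH.
Qed.

Lemma side_adj A o x y : x \in side A o -> adj x y -> (y \in side A o) || (y \in A).
Proof.
rewrite !inE => ox xy; have [|yA] := boolP (y \in A); first by rewrite orbT.
by rewrite (connect_trans ox) // connect1 // xy.
Qed.

Lemma separates_side A o b : o \notin A -> separates adj A o b -> b \notin side A o.
Proof.
move=> oA sep_ob; apply/negP; rewrite inE => /connectP[q0 /shortenP[q qp uq _] bE].
have qadj : path adj o q by apply: sub_path qp => x y /andP[].
have [a aA] := sep_ob q qadj uq (esym bE).
rewrite inE => /orP[/eqP ao|aq]; first by rewrite -ao aA in oA.
elim: q o qp aq {oA sep_ob bE qadj uq} => //= y q IH o /andP[/andP[_ yA] qp].
by rewrite inE => /orP[/eqP ay|]; [rewrite -ay aA in yA|apply: IH qp].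
Qed.
End Separation.

Unset Implicit Arguments.
Set Strict Implicit.
Set Printing Implicit Defensive.

(* The default value 1 of the iterated minimum is neutral, as probabilities are
   at most 1 and A is nonempty. *)
Theorem theorem3 (R : realType) (V : finType) (adj : rel V)
    (adj_sym : symmetric adj) (adj_irr : irreflexive adj)
    (p : {set V} -> R)
    (p01 : forall e, e \in edges adj -> 0 <= p e <= 1)
    (o b : V) (A : {set V})
    (cardA : #|A| = 3%N) (sepA : separates adj A o b) :
  \big[Num.min/1]_(a in A)
    percolation_prob (edges adj) p [predI connected_to o A & connected a b]
  <= percolation_prob (edges adj) p [predI connected o b & connected_to o A].
Proof.
(* If o is in A, the term a = o of the minimum suffices. *)
have [oA|oA] := boolP (o \in A).
  apply: le_trans (bigmin_le_cond _ _ oA) _ => /=.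
  by rewrite !percolation_probE; apply: le_prob => // w _ /andP[a1 a2]; apply/andP.
pose S := side adj A o.
(* Edges with both ends in A go to the side of b. *)
pose E1 := [set e in edges adj | e :&: S != set0].
pose E2 := edges adj :\: E1.
have sE1 : E1 \subset edges adj by apply/subsetP => e; rewrite inE => /andP[].
have EE : E1 :|: E2 = edges adj by rewrite /E2 -{1}(setIidPr sE1) setID.
have dE : [disjoint E1 & E2] by rewrite disjoints_subset /E2 setCD subsetUr.
have SA := side_disjoint adj oA.
have h1 x y : [set x; y] \in E1 -> (x \in S) || (x \in A).
  rewrite inE in_edges // => /andP[xy /set0Pn[z]].
  rewrite in_setI in_set2 => /andP[/orP[]/eqP-> zS]; first by rewrite zS.
  by apply: side_adj zS _; rewrite adj_sym.
have h2 x y : [set x; y] \in E2 -> x \notin S.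
  rewrite inE => /andP[nE1 eE]; apply: contra nE1 => xS.
  by rewrite inE eE /=; apply/set0Pn; exists x; rewrite in_setI set21.
have oS : o \in S by rewrite inE connect0.
have bS := separates_side oA sepA.
have [i [j [k AE]]] : exists i j k, A = [set i; j; k].
  have /card_gt0P[i iA] : (0 < #|A|)%N by rewrite cardA.
  have /cards2P[j [k [_ Ai]]] : #|A :\ i| == 2 by rewrite -eqSS -cardA (cardsD1 i A) iA.
  by exists i, j, k; rewrite -(setD1K iA) Ai setUA.
have pE1 : probability_on p E1 by move=> e; rewrite inE => /andP[/p01].
have pE2 : probability_on p E2 by move=> e; rewrite inE => /andP[_ /p01].
have D i' j' k' : A = [set i'; j'; k'] -> i' \in A ->
    0 <= deficit_at o b i' j' k' (prob p E1) (prob p E2) ->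
    \big[Num.min/1]_(a in A)
    percolation_prob (edges adj) p [predI connected_to o A & connected a b]
  <= percolation_prob (edges adj) p [predI connected o b & connected_to o A].
  move=> AE' iA; rewrite -(separation_deficit p dE h1 h2 SA AE' oS bS) EE subr_ge0.
  by apply: le_trans; apply: bigmin_le_cond iA.
have AEj : A = [set j; i; k] by rewrite AE [[set i; j]]setUC.
have AEk : A = [set k; i; j] by rewrite AE setUC setUA.
have iA : i \in A by rewrite AE !inE eqxx.
have jA : j \in A by rewrite AEj !inE eqxx.
have kA : k \in A by rewrite AEk !inE eqxx.
have := some_deficit_ge0 (percolation_profile o i j k pE1) (percolation_profile b i j k pE2).
case=> [h|h|h].
- exact: D AE iA h.
(* Up to exchanging the last two terminals in some patterns, this is the deficit with [j] in first
   place. *)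
- apply: (D _ _ _ AEj jA); rewrite /deficit_at.
  by rewrite !(prob_patternC p E1 o k j) !(prob_patternC p E2 b k j).
- apply: (D _ _ _ AEk kA); rewrite /deficit_at.
  by rewrite !(prob_patternC p E1 o i k) !(prob_patternC p E1 o j k)
    !(prob_patternC p E2 b i k) !(prob_patternC p E2 b j k).
Qed.
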